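(* Let $(\rho_n)_n$ be a sequence of reals bounded between two positive constants, and let $0<g_0<1$ and $a,c\ge 0$ be constants. For each $n$ consider a homogeneous rumor spreading process on $n$ nodes with success probabilities $p_k$ and covariance numbers $c_k$, and suppose that for all sufficiently large $n$ and all integers $u$ with $1\le u\le g_0n$, (i) $1-p_{n-u}\ge e^{-\rho_n}-a\frac{u}{n}$, and (ii) $c_{n-u}\le \frac{c}{u}$. Then there is a constant $g'\in\,]0,1[$ and there are further constants $A',\alpha'>0$ such that for any positive $g<g'$, $\mathbb{E}[T(n-\lfloor gn\rfloor,n)]\ge \frac{1}{\rho_n}\ln n+O(1)$, and $\Pr[T(n-\lfloor gn\rfloor,n)\le\frac1{\rho_n}\ln n-r]\le A'\exp(-\alpha' r)$ for all $r\in\mathbb{N}$.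
   Context: Homogeneous rumor spreading process on $n$ nodes: time proceeds in rounds $1,2,\dots$. Each node is informed or uninformed; informed nodes stay informed; the process starts with exactly one informed node. The process is memoryless: the events in a round depend only on which nodes are informed at the beginning of that round. Moreover, in any round starting with exactly $k$ informed nodes, each uninformed node becomes informed in that round with probability exactly $p_k$, a number depending only on $k$ (and on the process and $n$). The covariance number $c_k$ ($1\le k\le n-1$) is the smallest number such that, whenever a round starts with $k$ informed nodes, for any two uninformed nodes $x_1,x_2$ (distinct) the indicator random variables $X_1,X_2$ of the events that these nodes become informed in this round satisfy $\mathrm{Cov}[X_1,X_2]\le c_k$. $T(k,m)$ (with $k\le m\le n$) denotes the number of rounds it takes, starting from a moment at which exactly $k$ nodes are informed, until at least $m$ nodes are informed. One has one process for each $n$; the asymptotic statements are for $n\to\infty$, with $O(1)$ denoting a quantity (of either sign) bounded in absolute value by a constant independent of $n$.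
   Formalization: The constant A' is allowed to depend on g (g' and α' do not); with A' independent of g the tail bound is false, e.g. for independent informing with p_k = 1 − e^{−ρ}, a = c = 0 and g = e^{−ρr}. *)

(* Defs.v *)
From HB Require Import structures.
From mathcomp Require Import all_boot all_order all_algebra.
From mathcomp Require Import all_classical all_reals all_analysis.
Import Order.TTheory GRing.Theory Num.Theory.

Set Implicit Arguments.
Unset Strict Implicit.
Unset Printing Implicit Defensive.

Local Open Scope classical_set_scope.
Local Open Scope ring_scope.

(* [step S B] is the probability that a round starting with informed set [S]
   ends with informed set [B]; memorylessness is the fact that it depends on
   [S] only.  Nothing beyond being a distribution is asked of [step finset.set0],
   as the process starts with one informed node and never loses any. *)
Record rumor_process (R : realType) (n : nat) := RumorProcess {
  step : {set 'I_n} -> {set 'I_n} -> R;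
  success_prob : nat -> R;
  step_ge0 : forall S B, 0 <= step S B;
  step_sum1 : forall S, \sum_B step S B = 1;
  step_mono : forall S B : {set 'I_n}, step S B != 0 -> S \subset B;
  step_homogeneous : forall (S : {set 'I_n}) (x : 'I_n),
    S != finset.set0 -> x \notin S ->
    \sum_(B : {set 'I_n} | x \in B) step S B = success_prob #|S|
}.

Section OneRound.
Context (R : realType) (n : nat) (K : rumor_process R n).

Definition round_expectation (S : {set 'I_n}) (f : {set 'I_n} -> R) : R :=
  \sum_B step K S B * f B.

Definition round_covariance (S : {set 'I_n}) (f g : {set 'I_n} -> R) : R :=
  round_expectation S (fun B =>
    (f B - round_expectation S f) * (g B - round_expectation S g)).

Definition informed_indic (x : 'I_n) (B : {set 'I_n}) : R := (x \in B)%:R.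

(* The least upper bound is taken in the extended reals because there is no
   pair of distinct uninformed nodes when k = n - 1; the value is then -oo. *)
Definition covariance_number (k : nat) : \bar R :=
  ereal_sup [set e | exists (S : {set 'I_n}) (x1 x2 : 'I_n),
    [/\ #|S| = k, x1 \notin S, x2 \notin S, x1 != x2 &
        e = (round_covariance S (informed_indic x1) (informed_indic x2))%:E]].

End OneRound.

Section Trajectories.
Context (R : realType) (n : nat) (K : rumor_process R n).
Context (d : measure_display) (Omega : measurableType d).
Context (P : probability Omega R).

(* [X t] is the set of informed nodes after [t] rounds, counted from a moment
   at which exactly [k] nodes are informed (which set of [k] nodes this is may
   be random). *)
Record spread_from (k : nat) (X : nat -> Omega -> {set 'I_n}) : Prop := {
  spread_measurable : forall t S, measurable [set w | X t w = S];
  spread_start : P [set w | #|X 0 w| = k] = 1%E;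
  spread_markov : forall (s : nat -> {set 'I_n}) (t : nat),
    P [set w | forall i, (i <= t.+1)%N -> X i w = s i] =
    (P [set w | forall i, (i <= t)%N -> X i w = s i] *
      (step K (s t) (s t.+1))%:E)%E
}.

End Trajectories.

(* The first round after which at least m nodes are informed; +oo if none. *)
Definition spread_time (R : realType) (n : nat) (Omega : Type)
    (X : nat -> Omega -> {set 'I_n}) (m : nat) (w : Omega) : \bar R :=
  ereal_inf [set (t%:R)%:E | t in [set t | (m <= #|X t w|)%N]].

(* Main.v *)
Require Import Defs.
From HB Require Import structures.
From mathcomp Require Import all_boot all_order all_algebra.
From mathcomp Require Import all_classical all_reals all_analysis.
From mathcomp Require Import measurable_realfun ring lra.
Import Order.TTheory GRing.Theory Num.Theory.

Set Implicit Arguments.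
Unset Strict Implicit.
Unset Printing Implicit Defensive.

Local Open Scope classical_set_scope.
Local Open Scope ring_scope.

(* Write q = e^{-rho}.  With v uninformed nodes, after one round their number
   has mean at least v (q - a v / n) and variance at most (1 + c) v, so by
   Chebyshev's inequality it is at least (1 - delta) times that mean, except
   with probability O(1 / (delta^2 v)).  Index the rounds by the number t of
   rounds that remain, and let delta_t be of order s^t with s^4 >= q: there are
   thresholds w_t of order W q^{-t} with
   w_t <= (1 - delta_{t+1}) w_{t+1} (q - a w_{t+1} / n), and the failure
   probabilities O(q^t / (s^{2t} W)) sum to O(1 / W).  Hence a process starting
   with at least w_t uninformed nodes is complete within t rounds with
   probability O(1 / W).  For t <= ln n / rho - r one can take W of order
   e^{rho r} while w_t is at most a small multiple of n; this is the tail bound,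
   and summing it over r bounds the expectation. *)

(** * One round: Chebyshev's inequality for the number of uninformed nodes *)

Section OneRoundBound.
Context (R : realType) (n : nat) (K : rumor_process R n).
Implicit Types (S B : {set 'I_n}) (x y : 'I_n).

Local Notation expect := (round_expectation K).

Lemma round_expectation_const S (a : R) : expect S (fun=> a) = a.
Proof. by rewrite /round_expectation -mulr_suml step_sum1 mul1r. Qed.

Lemma round_expectation_sum S (I : finType) (P : pred I)
    (f : I -> {set 'I_n} -> R) :
  expect S (fun B => \sum_(i | P i) f i B) = \sum_(i | P i) expect S (f i).
Proof.
rewrite /round_expectation exchange_big /=.
by apply: eq_bigr => B _; rewrite mulr_sumr.
Qed.

Lemma ler_round_expectation S (f g : {set 'I_n} -> R) :
  (forall B, S \subset B -> f B <= g B) -> expect S f <= expect S g.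
Proof.
move=> fg; apply: ler_sum => B _.
have [->|sB] := eqVneq (step K S B) 0; first by rewrite !mul0r.
by rewrite ler_wpM2l ?step_ge0 ?fg ?(step_mono sB).
Qed.

Lemma round_expectation_indic S x : S != finset.set0 -> x \notin S ->
  expect S (informed_indic R x) = success_prob K #|S|.
Proof.
move=> S0 xS.
rewrite -(step_homogeneous K S0 xS) /round_expectation [RHS]big_mkcond.
apply: eq_bigr => B _; rewrite /informed_indic.
by case: (x \in B); rewrite ?mulr1 ?mulr0.
Qed.

Lemma success_prob_itv S x : S != finset.set0 -> x \notin S ->
  0 <= success_prob K #|S| <= 1.
Proof.
move=> S0 xS; rewrite -(round_expectation_indic S0 xS).
apply/andP; split.
  rewrite -[leLHS](round_expectation_const S).
  apply: ler_round_expectation => B _.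
  by rewrite /informed_indic ler0n.
rewrite -[leRHS](round_expectation_const S); apply: ler_round_expectation => B _.
by rewrite /informed_indic lern1 leq_b1.
Qed.

Lemma round_variance_indic_le1 S x : S != finset.set0 -> x \notin S ->
  round_covariance K S (informed_indic R x) (informed_indic R x) <= 1.
Proof.
move=> S0 xS; rewrite /round_covariance -[leRHS](round_expectation_const S 1).
apply: ler_round_expectation => B _; rewrite round_expectation_indic//.
have := success_prob_itv S0 xS; rewrite /informed_indic.
by case: (x \in B) => /= /andP[p0 p1]; nra.
Qed.

(** The variance is a sum of [u] diagonal terms, each at most 1, and of at most [u ^ 2] covariances,
    each at most [c / u]; in all at most [u * (1 + c)]. Only a lower bound [m] of the mean is known,
    which suffices for the lower tail. *)
Lemma uninformed_tail_le S (c m w : R) :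
  let u := #|~: S|%:R in
  S != finset.set0 -> 0 <= c ->
  m <= u * (1 - success_prob K #|S|) ->
  (covariance_number K #|S| <= (c / u)%:E)%E ->
  w < m ->
  \sum_(B : {set 'I_n} | #|~: B|%:R < w) step K S B <=
    u * (1 + c) / (m - w) ^+ 2.
Proof.
move=> u S0 c0 mE cov wm; set p := success_prob K #|S| in mE.
(* The centred number of newly informed nodes, hence also the mean number of remaining nodes minus
   their actual number ([ZE]). *)
pose Z B : R := \sum_(x in ~: S) (informed_indic R x B - p).
have ZE B : S \subset B -> Z B = u * (1 - p) - #|~: B|%:R.
  move=> SB; rewrite /Z sumrB sumr_const -mulr_natl -/u.
  have -> : \sum_(x in ~: S) informed_indic R x B = #|B :\: S|%:R.
    rewrite -sum1_card natr_sum big_mkcond [RHS]big_mkcond /=.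
    apply: eq_bigr => x _; rewrite /informed_indic !inE.
    by case: (x \in S); case: (x \in B).
  have -> : #|~: B|%:R = u - #|B :\: S|%:R :> R.
    apply/eqP; rewrite eq_sym subr_eq -natrD; apply/eqP; congr (_%:R).
    rewrite -(finset.cardsID (~: B) (~: S)); congr (_ + _)%N.
      apply: eq_card => x; rewrite !inE andbC; case xB: (x \in B) => //=.
      by apply: contraFT xB => /negPn /(fintype.subsetP SB).
    by apply: eq_card => x; rewrite !inE negbK andbC.
  by ring.
have varZ : expect S (fun B => Z B ^+ 2) <= u * (1 + c).
  under [X in expect S X]boolp.funext => B.
    rewrite expr2 [X in _ * X]/Z mulr_sumr.
    under eq_bigr => x _ do rewrite /Z mulr_suml.
    over.
  rewrite round_expectation_sum.
  under eq_bigr => x _ do rewrite round_expectation_sum.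
  (* The case [u = 0] is apart because [u * (c / u) = c] fails there. *)
  have [u0|u_gt0] := posnP #|~: S|.
    move: (u0) => /eqP; rewrite cards_eq0 => /eqP ->.
    by rewrite big_set0 /u u0 mul0r.
  have u0 : u != 0 by rewrite pnatr_eq0 -lt0n.
  (* Allowing [c / u >= 0] on the diagonal too makes each row sum to exactly [1 + c]. *)
  have inner x y : x \in ~: S -> y \in ~: S ->
      expect S (fun B => (informed_indic R y B - p) * (informed_indic R x B - p))
      <= (y == x)%:R + c / u.
    rewrite !inE => xS yS; have cu : 0 <= c / u by rewrite divr_ge0.
    have [->|yx] := eqVneq y x.
      have := round_variance_indic_le1 S0 xS.
      rewrite /round_covariance round_expectation_indic// => /le_trans; apply.
      by rewrite lerDl.
    rewrite add0r -lee_fin; apply: le_trans cov.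
    apply: ereal_sup_ubound; exists S, y, x; split => //.
    by rewrite /round_covariance !round_expectation_indic.
  apply: (@le_trans _ _ (\sum_(x in ~: S) (1 + c))); last first.
    by rewrite sumr_const -mulr_natl.
  apply: ler_sum => x xS.
  apply: (le_trans (ler_sum _ (fun y yS => inner x y xS yS))).
  rewrite big_split/= sumr_const -mulr_natl -/u mulrCA divff// mulr1 lerD2r.
  by rewrite (bigD1 x)//= eqxx big1 ?addr0// => y /andP[_ /negbTE->].
have mw : 0 < m - w by rewrite subr_gt0.
rewrite ler_pdivlMr ?exprn_gt0//; apply: le_trans varZ.
rewrite /round_expectation mulr_suml big_mkcond/=.
apply: ler_sum => B _.
have [->|/step_mono SB] := eqVneq (step K S B) 0; first by rewrite !mul0r if_same.
(* On the event, [Z B >= m - w > 0]: this is Markov's inequality for [Z ^ 2]. *)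
case: ifPn => [Bw|_]; last by rewrite mulr_ge0 ?step_ge0 ?sqr_ge0.
rewrite ler_wpM2l ?step_ge0// ZE// ler_sqr ?nnegrE; lra.
Qed.
End OneRoundBound.

(** The probability of completion within [t] rounds from [S], computed from the kernel alone, so
    that all estimates precede the choice of a probability space. *)
Fixpoint hit_prob (R : realType) (n : nat) (K : rumor_process R n) (t : nat)
    (S : {set 'I_n}) : R :=
  if t is t'.+1 then
    if S == [set: 'I_n]%SET then 1 else \sum_B step K S B * hit_prob K t' B
  else (S == [set: 'I_n]%SET)%:R.

Lemma hit_prob_itv (R : realType) (n : nat) (K : rumor_process R n) t S :
  0 <= hit_prob K t S <= 1.
Proof.
elim: t S => [|t IH] S /=; first by rewrite ler0n lern1 leq_b1.
case: ifP => _; first by rewrite ler01 lexx.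
apply/andP; split.
  by rewrite sumr_ge0// => B _; rewrite mulr_ge0 ?step_ge0//; case/andP: (IH B).
rewrite -[leRHS](step_sum1 K S); apply: ler_sum => B _.
by rewrite ler_piMr ?step_ge0//; case/andP: (IH B).
Qed.

(** * The thresholds and their drift *)

Section Thresholds.
Context (R : realType) (q s k W : R).
Implicit Types t : nat.

(* The thresholds exceed W / q ^ t by a factor in [1, 3]: the increments of
   - s ^ t pay for the deviations from the mean, those of k * geom_level t for
   the quadratic loss in the mean. *)
Definition geom_level t := W / q ^+ t.
Definition correction t := 2 - s ^+ t + k * geom_level t.
Definition threshold t := geom_level t * correction t.

Hypotheses (q0 : 0 < q) (q1 : q < 1) (s0 : 0 < s) (s1 : s < 1).
Hypotheses (k0 : 0 <= k) (W0 : 0 < W).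

Lemma geom_level_gt0 t : 0 < geom_level t.
Proof. by rewrite divr_gt0// exprn_gt0. Qed.

Lemma geom_levelS t : geom_level t = q * geom_level t.+1.
Proof.
by rewrite /geom_level exprS; field; rewrite expf_neq0 !gt_eqF.
Qed.

Lemma geom_level_le t : geom_level t <= geom_level t.+1.
Proof. by rewrite geom_levelS ger_pMl ?geom_level_gt0// ltW. Qed.

Lemma correction_ge1 t : 1 <= correction t.
Proof.
have : s ^+ t <= 1 by rewrite exprn_ile1 ?ltW.
have : 0 <= k * geom_level t by rewrite mulr_ge0// ltW// geom_level_gt0.
rewrite /correction; lra.
Qed.

Lemma correction_le3 t : k * geom_level t <= 1 -> correction t <= 3.
Proof. by have := exprn_ge0 t (ltW s0); rewrite /correction; lra. Qed.

Lemma threshold_gt0 t : 0 < threshold t.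
Proof.
by rewrite mulr_gt0 ?geom_level_gt0// (lt_le_trans ltr01) ?correction_ge1.
Qed.

(** With [D = correction t.+1] and [y = geom_level t.+1], the passage to [correction t] gives up
    [s ^ t * (1 - s)] and [k * (1 - q) * y]. Since [1 <= D <= 3], the first covers the relative
    deviation (hence its divisor 3), and the second covers the quadratic loss
    [b * y * D ^ 2 <= 9 * b * y] (hence the 9). *)
Lemma threshold_drift (b : R) t : 0 <= b -> 9 * b <= k * (q * (1 - q)) ->
  k * geom_level t.+1 <= 1 ->
  threshold t <= (1 - s ^+ t * (1 - s) / 3) *
    (threshold t.+1 * (q - b * threshold t.+1)).
Proof.
move=> b0 bk ky; set y := geom_level t.+1 in ky *.
have y0 : 0 < y := geom_level_gt0 _.
have D1 := correction_ge1 t.+1; have D3 := correction_le3 ky.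
have DE : correction t =
    correction t.+1 - s ^+ t * (1 - s) - k * (1 - q) * y.
  by rewrite /correction geom_levelS -/y exprS; ring.
rewrite /threshold DE geom_levelS -/y.
clearbody y; set D := correction t.+1 in D1 D3 *; set e := s ^+ t.
have e0 : 0 <= e by rewrite exprn_ge0// ltW.
have e1 : e <= 1 by rewrite exprn_ile1 ?ltW.
set dl := e * (1 - s) / 3.
have dl0 : 0 <= dl by rewrite divr_ge0// mulr_ge0// subr_ge0 ltW.
have -> : e * (1 - s) = 3 * dl by rewrite /dl; field.
clearbody dl; have -> : (1 - dl) * (y * D * (q - b * (y * D))) =
  y * ((1 - dl) * (D * q - b * y * D ^+ 2)) by ring.
have -> : q * y * (D - 3 * dl - k * (1 - q) * y) =
  y * (q * D - 3 * q * dl - k * (q * (1 - q)) * y) by ring.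
rewrite ler_pM2l//.
have DD : b * y * D ^+ 2 <= 9 * b * y.
  rewrite [leRHS](_ : _ = b * y * 9); last by ring.
  rewrite ler_wpM2l ?mulr_ge0 ?(ltW y0)// (_ : 9 = 3 ^+ 2 :> R); last by ring.
  by rewrite ler_sqr ?nnegrE// (le_trans ler01).
have h1 : 9 * b * y <= k * (q * (1 - q)) * y by rewrite ler_wpM2r// ltW.
have h2 : 0 <= dl * (b * y * D ^+ 2).
  by rewrite mulr_ge0// mulr_ge0 ?sqr_ge0// mulr_ge0// ltW.
have h3 : dl * (q * D) <= dl * (q * 3) by rewrite !ler_wpM2l// ltW.
lra.
Qed.

End Thresholds.

(** * Induction on the number of remaining rounds *)

Section HitBound.
Context (R : realType) (n : nat) (K : rumor_process R n).
Context (q b c k W s G : R).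
Hypotheses (q0 : 0 < q) (q1 : q < 1) (s0 : 0 < s) (s1 : s < 1).
Hypotheses (b0 : 0 <= b) (c0 : 0 <= c) (k0 : 0 <= k) (W0 : 0 < W).
Hypotheses (bk : 9 * b <= k * (q * (1 - q))) (qs : q <= s ^+ 4).
Hypotheses (bG : 4 * b * G <= q) (Gn : G < n%:R).
Hypothesis drift : forall u : nat, (1 <= u)%N -> u%:R <= G ->
  q - b * u%:R <= 1 - success_prob K (n - u)%N.
Hypothesis cov : forall u : nat, (1 <= u)%N -> u%:R <= G ->
  (covariance_number K (n - u)%N <= (c / u%:R)%:E)%E.

Local Notation y := (geom_level q W).
Local Notation w := (threshold q s k W).

(** Here 36 is [3 ^ 2 * 2 ^ 2]: the 3 divides the relative deviation, the 2 comes from a mean of at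
    least [v * q / 2]. *)
Let C1 := 36 * (1 + c) / (q * (1 - s) ^+ 2).

(** The margin between mean and threshold is at least [dl * (v * q / 2)], so the one-round bound is
    of order [1 / (dl ^ 2 * v)]. As [v >= W / q ^ t.+1], this is of order [q ^ t / (s ^ (2 t) * W)],
    and [q <= s ^ 4] makes it geometric in [t]. *)
Lemma round_below_threshold t (S : {set 'I_n}) :
  k * y t.+1 <= 1 -> w t.+1 <= #|~: S|%:R -> #|~: S|%:R <= G ->
  \sum_(B : {set 'I_n} | #|~: B|%:R < w t) step K S B <=
    C1 * (s ^+ 2) ^+ t / W.
Proof.
move=> ky wS SG.
have [[q_gt0 s_gt0] s_lt1] := (q0, s0, s1).
have wt0 := threshold_gt0 q0 s0 s1 k0 W0 t.+1.
have u1 : (1 <= #|~: S|)%N by rewrite -(ltr0n R) (lt_le_trans wt0).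
have SE : #|S| = (n - #|~: S|)%N.
  by have := cardsC S; rewrite card_ord => /(canRL (addnK _)).
set v : R := #|~: S|%:R in wS SG *.
have v0 : 0 < v by rewrite ltr0n.
have S0 : S != finset.set0.
  apply: contraTneq (Gn) => SS; rewrite -leNgt (le_trans _ SG)//.
  by rewrite /v SS finset.setC0 cardsT card_ord.
set m := v * (q - b * v).
have mE : m <= v * (1 - success_prob K #|S|).
  by rewrite ler_wpM2l ?SE ?drift// ltW.
have bv : 4 * b * v <= q by apply: le_trans bG; rewrite ler_wpM2l// mulr_ge0.
have bw : 4 * b * w t.+1 <= q.
  by apply: le_trans bv; rewrite ler_wpM2l// mulr_ge0.
have mq : v * q / 2 <= m.
  by rewrite -mulrA ler_wpM2l ?(ltW v0)//; lra.
(* The map [x |-> x * (q - b * x)] increases from [w t.+1] to [v], because [b * v] and [b * w t.+1]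
   are at most [q / 4]; so the worst case is [v = w t.+1]. *)
have wm : w t.+1 * (q - b * w t.+1) <= m.
  rewrite -subr_ge0 [X in 0 <= X](_ : _ =
    (v - w t.+1) * (q - b * v - b * w t.+1)); last by rewrite /m; ring.
  by rewrite mulr_ge0 ?subr_ge0//; lra.
set e := s ^+ t; set dl := e * (1 - s) / 3.
have e0 : 0 < e by rewrite exprn_gt0.
have e1 : e <= 1 by rewrite exprn_ile1 ?ltW.
have dl0 : 0 < dl by rewrite divr_gt0// mulr_gt0// subr_gt0.
have dl1 : dl <= 1 by rewrite /dl; nra.
have wtm : w t <= (1 - dl) * m.
  apply: (le_trans (threshold_drift q0 s0 s1 k0 W0 b0 bk ky)).
  by rewrite -/e -/dl ler_wpM2l// subr_ge0.
have gap : dl * (v * q / 2) <= m - w t.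
  have : dl * (v * q / 2) <= dl * m by rewrite ler_wpM2l// ltW.
  lra.
have gap0 : 0 < dl * (v * q / 2) by rewrite mulr_gt0// divr_gt0// mulr_gt0.
have wtm' : w t < m by rewrite -subr_gt0 (lt_le_trans gap0).
apply: le_trans (uninformed_tail_le S0 c0 mE _ wtm') _.
  by rewrite SE cov.
apply: (@le_trans _ _ (v * (1 + c) / (dl * (v * q / 2)) ^+ 2)).
  rewrite ler_wpM2l ?mulr_ge0 ?(ltW v0) ?addr_ge0// lef_pV2 ?posrE ?exprn_gt0//.
    by rewrite ler_sqr ?nnegrE ?(ltW gap0)// (le_trans (ltW gap0)).
  by rewrite subr_gt0.
have yv : y t.+1 <= v.
  apply: le_trans wS; rewrite /threshold ler_peMr ?correction_ge1//.
  exact/ltW/geom_level_gt0.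
have y0 : 0 < y t.+1 := geom_level_gt0 q0 W0 _.
have s1' : 0 < 1 - s by rewrite subr_gt0.
rewrite [leLHS](_ : _ = 36 * (1 + c) / (q * (1 - s)) ^+ 2 / e ^+ 2 * v^-1);
  last by rewrite /dl; field; rewrite !gt_eqF.
apply: (@le_trans _ _
  (36 * (1 + c) / (q * (1 - s)) ^+ 2 / e ^+ 2 * (y t.+1)^-1)).
  by rewrite ler_wpM2l ?lef_pV2 ?posrE// !mulr_ge0 ?invr_ge0 ?sqr_ge0 ?addr_ge0.
rewrite [leLHS](_ : _ = C1 / W * (q ^+ t / e ^+ 2)); last first.
  have : 0 < q ^+ t by rewrite exprn_gt0.
  rewrite /C1 /geom_level (exprS q); move: (q ^+ t) => Q Q0; clearbody e.
  by field; rewrite !gt_eqF.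
rewrite [leRHS](_ : _ = C1 / W * (s ^+ 2) ^+ t); last by ring.
rewrite ler_wpM2l//.
  rewrite divr_ge0 ?(ltW W0)// /C1 divr_ge0//.
    by rewrite mulr_ge0 ?addr_ge0.
  by rewrite mulr_ge0 ?sqr_ge0// ltW.
rewrite ler_pdivrMr ?exprn_gt0//.
apply: (@le_trans _ _ ((s ^+ 4) ^+ t)).
  by rewrite lerXn2r ?nnegrE ?exprn_ge0 ?(ltW s0) ?(ltW q0).
by rewrite /e -!exprM -exprD (mulnC 2%N) -mulnDr mulnC.
Qed.

(** A union bound over the rounds: either the next round falls below its threshold, or the induction
    hypothesis applies to the new set. The bound by [G] persists because uninformed nodes never
    increase in number. *)
Lemma hit_prob_le t (S : {set 'I_n}) :
  k * y t <= 1 -> w t <= #|~: S|%:R -> #|~: S|%:R <= G ->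
  hit_prob K t S <= C1 / (1 - s ^+ 2) / W.
Proof.
have [[[q_gt0 s_gt0] s_lt1] W_gt0] := (q0, s0, s1, W0).
have s2 : 0 < 1 - s ^+ 2 by nra.
have C1_ge0 : 0 <= C1.
  rewrite /C1 divr_ge0//; first by rewrite mulr_ge0 ?addr_ge0.
  by rewrite mulr_ge0 ?sqr_ge0// ltW.
have nfull t' (B : {set 'I_n}) :
    w t' <= #|~: B|%:R -> (B == [set: 'I_n]%SET) = false.
  move=> wB; apply/negbTE; apply: contraTneq wB => ->.
  by rewrite finset.setCT cards0 -ltNge threshold_gt0.
(* The induction carries the partial geometric sum of ratio [s ^ 2], to which each round adds one
   term. *)
suff H : forall t (S : {set 'I_n}), k * y t <= 1 -> w t <= #|~: S|%:R ->
    #|~: S|%:R <= G ->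
    hit_prob K t S <= C1 * ((1 - (s ^+ 2) ^+ t) / (1 - s ^+ 2)) / W.
  move=> ky wS SG; apply: le_trans (H _ _ ky wS SG) _.
  rewrite ler_pM2r ?invr_gt0// ler_wpM2l// ler_pdivrMr// mulVf ?gt_eqF//.
  by rewrite lerBlDr lerDl exprn_ge0// sqr_ge0.
elim=> [{}S _ wS SG|{}t IH {}S ky wS SG] /=.
  by rewrite (nfull _ _ wS) expr0 subrr mul0r mulr0 mul0r.
have ky' : k * y t <= 1.
  by apply: le_trans ky; rewrite ler_wpM2l// geom_level_le.
rewrite (nfull _ _ wS) (bigID (fun B : {set 'I_n} => #|~: B|%:R < w t))/=.
rewrite [leRHS](_ : _ = C1 * (s ^+ 2) ^+ t / W +
  C1 * ((1 - (s ^+ 2) ^+ t) / (1 - s ^+ 2)) / W); last first.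
  by rewrite exprS; field; rewrite !gt_eqF.
set eps := C1 * _ / W in IH *.
apply: lerD.
  apply: le_trans (round_below_threshold ky wS SG).
  apply: ler_sum => B _; rewrite ler_piMr ?step_ge0//.
  by case/andP: (hit_prob_itv K t B).
apply: (@le_trans _ _
  (\sum_(B : {set 'I_n} | ~~ (#|~: B|%:R < w t)) step K S B * eps)).
  apply: ler_sum => B; rewrite -leNgt => wB.
  have [->|SB] := eqVneq (step K S B) 0; first by rewrite !mul0r.
  rewrite ler_wpM2l ?step_ge0// IH// (le_trans _ SG)// ler_nat subset_leq_card//.
  by rewrite finset.setCS (step_mono SB).
rewrite -mulr_suml ler_piMl//.
  rewrite /eps divr_ge0 ?(ltW W0)// mulr_ge0// divr_ge0 ?(ltW s2)// subr_ge0.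
  by rewrite exprn_ile1 ?sqr_ge0// exprn_ile1 ?ltW.
rewrite -[leRHS](step_sum1 K S).
rewrite [leRHS](bigID (fun B : {set 'I_n} => #|~: B|%:R < w t))/=.
by rewrite lerDr sumr_ge0// => B _; rewrite step_ge0.
Qed.

End HitBound.

(** * From the kernel to trajectories *)

Lemma measure_finType_partition (R : realType) d (T : measurableType d)
    (mu : {measure set T -> \bar R}) (I : finType) (Y : T -> I) (E : set T) :
  measurable E -> (forall i, measurable (Y @^-1` [set i])) ->
  mu E = (\sum_i mu (E `&` (Y @^-1` [set i])))%E.
Proof.
move=> mE mY.
have -> : mu E = mu (\bigcup_(i in [set: I]) (E `&` (Y @^-1` [set i]))).
  by congr (mu _); apply/seteqP; split => [w Ew|w [i _ []]//]; exists (Y w).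
rewrite measure_fin_bigcup//.
- rewrite (fsbigE (index_enum I)) ?index_enum_uniq//.
    by apply: eq_bigl => i; rewrite mem_setT.
  by move=> i _ /=; rewrite mem_index_enum.
- exact: finite_finset.
- by move=> i j _ _ [w [[_ <-] [_ <-]]].
- by move=> i _; exact: measurableI.
Qed.

Section HittingTime.
Context (R : realType) (n : nat) (K : rumor_process R n).
Context (d : measure_display) (Omega : measurableType d).
Context (P : probability Omega R) (k : nat) (X : nat -> Omega -> {set 'I_n}).
Hypothesis HX : spread_from K P k X.
Local Notation full := [set: 'I_n]%SET.
Implicit Types (s : nat -> {set 'I_n}).

Let cylinder s j : set Omega := [set w | forall i, (i <= j)%N -> X i w = s i].
Let hit_in j t : set Omega :=
  [set w | exists2 i, (j <= i <= j + t)%N & X i w = full].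

Lemma measurable_cylinder s j : measurable (cylinder s j).
Proof.
rewrite (_ : cylinder s j =
  \bigcap_(i in [set i | (i <= j)%N]) [set w | X i w = s i]).
  by apply: bigcap_measurableType => i _; exact: spread_measurable HX _ _.
by apply/seteqP; split => w /= H i; exact: H.
Qed.

Lemma measurable_hit_in j t : measurable (hit_in j t).
Proof.
rewrite (_ : hit_in j t =
  \bigcup_(i in [set i | (j <= i <= j + t)%N]) [set w | X i w = full]).
  by apply: bigcup_measurable => i _; exact: spread_measurable HX _ _.
by apply/seteqP; split => w /= [i ij Xi]; exists i.
Qed.

(** The whole past is fixed because the Markov property is stated for cylinders. If [s j] is not
    full, completion occurs from round [j.+1] on; one splits according to [X j.+1]. *)
Lemma cylinder_hit_le s j t :
  (P (cylinder s j `&` hit_in j t) <=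
   P (cylinder s j) * (hit_prob K t (s j))%:E)%E.
Proof.
have mC := measurable_cylinder; have mH := measurable_hit_in.
have mX i S : measurable [set w | X i w = S] by exact: spread_measurable HX _ _.
have sub s' j' t' : (P (cylinder s' j' `&` hit_in j' t') <= P (cylinder s' j'))%E.
  apply: le_measure; rewrite ?inE; [exact: measurableI|exact: mC|].
  exact: subIsetl.
elim: t s j => [|t IH] s j /=.
  have [sj|sj] := eqVneq (s j) full; first by rewrite mule1.
  rewrite mule0 le_eqVlt; apply/orP; left; apply/eqP.
  rewrite (_ : _ `&` _ = set0) ?measure0// -subset0 => w [/= cw [i]].
  rewrite addn0 -eqn_leq => /eqP <-; rewrite cw// => sj'.
  by rewrite sj' eqxx in sj.
case: ifPn => [_|sj]; first by rewrite mule1.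
rewrite (measure_finType_partition P (Y := X j.+1)); last 2 first.
- exact: measurableI.
- by move=> S; exact: mX.
(* The path [s] prolonged by [B] at time [j.+1]. *)
pose upd B i := if i == j.+1 then B else s i.
have updE B : cylinder (upd B) j = cylinder s j.
  by apply/seteqP; split => w /= H i ij; rewrite H// /upd ltn_eqF.
apply: (@le_trans _ _ (\sum_B P (cylinder (upd B) j.+1 `&` hit_in j.+1 t))%E).
  apply: lee_sum => B _; apply: le_measure; rewrite ?inE.
  - by apply: measurableI; [exact: measurableI|exact: mX].
  - exact: measurableI.
  move=> w [[/= cw [i /andP[ji ijt] Xi]] XB]; split.
    move=> i'; rewrite leq_eqVlt ltnS /upd => /orP[/eqP->|i'j].
      by rewrite eqxx.
    by rewrite ltn_eqF// cw.
  exists i => //; rewrite addSnnS ijt andbT ltn_neqAle ji andbT.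
  by apply: contraNneq sj => jE; rewrite -(cw j)// jE Xi.
rewrite -sumEFin ge0_sume_distrr; last first.
  move=> B _; rewrite lee_fin mulr_ge0 ?step_ge0//.
  by case/andP: (hit_prob_itv K t B).
apply: lee_sum => B _; apply: le_trans (IH (upd B) j.+1) _.
rewrite {1}/cylinder (spread_markov HX) -/(cylinder _ _) updE /upd eqxx.
by rewrite ltn_eqF// EFinM muleA.
Qed.

Lemma prob_hit_le (eps : R) t : 0 <= eps ->
  (forall S : {set 'I_n}, #|S| = k -> hit_prob K t S <= eps) ->
  (P (hit_in 0 t) <= eps%:E)%E.
Proof.
move=> eps0 H.
have mX i S : measurable [set w | X i w = S] by exact: spread_measurable HX _ _.
have start (S : {set 'I_n}) : #|S| != k -> P [set w | X 0%N w = S] = 0%E.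
  move=> Sk; apply/eqP; rewrite eq_le measure_ge0 andbT.
  have mk : measurable [set w | #|X 0%N w| = k].
    rewrite (_ : [set w | _] = \bigcup_(S in [set S : {set 'I_n} | #|S| = k])
      [set w | X 0%N w = S]).
      apply: fin_bigcup_measurable => [|S' _]; last exact: mX.
      exact: finite_finset.
    by apply/seteqP; split => [w /= Xk|w [S' /= <- ->]//]; exists (X 0%N w).
  apply: (@le_trans _ _ (P (~` [set w | #|X 0%N w| = k]))).
    apply: le_measure; rewrite ?inE//; first exact: measurableC.
    by move=> w /= -> /eqP; exact/negP.
  by rewrite probability_setC// (spread_start HX) subee.
rewrite (measure_finType_partition P (Y := X 0%N)) => [||S]; last 2 first.
- exact: measurable_hit_in.
- exact: mX.
apply: (@le_trans _ _ (\sum_S P [set w | X 0%N w = S] * eps%:E)%E).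
  apply: lee_sum => S _.
  have cE : cylinder (fun=> S) 0 = [set w | X 0%N w = S].
    apply/seteqP; split => w /=; first exact.
    by move=> XS i; rewrite leqn0 => /eqP ->.
  rewrite setIC (_ : X 0%N @^-1` [set S] = cylinder (fun=> S) 0) ?cE//.
  rewrite -[in leLHS]cE.
  apply: le_trans (cylinder_hit_le _ _ _) _; rewrite cE.
  have [Sk|Sk] := eqVneq #|S| k; last by rewrite start// !mul0e.
  by rewrite lee_wpmul2l// lee_fin H.
rewrite -ge0_sume_distrl// -[leRHS]mul1e lee_wpmul2r// -(probability_setT P).
rewrite (measure_finType_partition P (Y := X 0%N) (E := setT)) => [||S];
  last 2 first.
- exact: measurableT.
- exact: mX.
by under [leRHS]eq_bigr do rewrite setTI.
Qed.

Lemma spread_time_leP (x : R) w :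
  (spread_time R X n w <= x%:E)%E <-> exists2 t : nat, t%:R <= x & X t w = full.
Proof.
have fullE t : (n <= #|X t w|)%N <-> X t w = full.
  split=> [nX|->]; last by rewrite cardsT card_ord.
  by apply/eqP; rewrite finset.eqEcard finset.subsetT cardsT card_ord.
split=> [le_x|[t tx /fullE Xt]]; last first.
  by apply: le_trans (_ : _ <= t%:R%:E)%E _; rewrite ?lee_fin//;
    apply: ereal_inf_lbound; exists t.
(* The strict bound [x + 1] only serves to show that some completion round exists; the least one
   then attains the infimum. *)
have : (spread_time R X n w < (x + 1)%:E)%E.
  by apply: le_lt_trans le_x _; rewrite lte_fin ltrDl.
move=> /ereal_inf_lt[_ [t0 /= nX0 <-]] _.
have ex : exists t, (n <= #|X t w|)%N by exists t0.
case: (ex_minnP ex) => t nX tmin; exists t; last exact/fullE.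
rewrite -lee_fin; apply: le_trans le_x.
apply: le_ereal_inf_tmp => _ [t' /= nX' <-].
by rewrite lee_fin ler_nat tmin.
Qed.

(** Negative [x] is apart because [Num.truncn] sends it to 0, and round 0 may already be
    complete. *)
Lemma spread_time_le_hit (x : R) :
  [set w | (spread_time R X n w <= x%:E)%E] =
  if x < 0 then set0 else hit_in 0 (Num.truncn x).
Proof.
apply/seteqP; case: ltP => x0; split=> w //=.
- by move=> /spread_time_leP[t tx _]; have := lt_le_trans x0 (ler0n _ t);
    rewrite ltNge tx.
- move=> /spread_time_leP[t tx Xt]; exists t => //.
  by rewrite add0n truncn_ge_nat.
- move=> [t /=]; rewrite add0n truncn_ge_nat// => tx Xt.
  by apply/spread_time_leP; exists t.
Qed.

End HittingTime.

(** * From tail bounds to a lower bound of the expectation *)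

Lemma le_count_nat_le (R : realType) (x : R) m : x <= m%:R ->
  x <= \sum_(r < m) (r%:R <= x)%R%:R.
Proof.
elim: m => [|m IH] xm; first by rewrite big_ord0.
have [xm'|mx] := leP x m%:R.
  by rewrite big_ord_recr/= (le_trans (IH xm'))// lerDl.
(* Here [m < x <= m.+1], so all [m.+1] indices are counted. *)
apply: (le_trans xm).
rewrite -[leLHS]mulr1 mulr_natl -{1}(card_ord m.+1) -sumr_const.
apply: ler_sum => r _; rewrite (_ : r%:R <= x)%R//.
by rewrite (le_trans _ (ltW mx))// ler_nat -ltnS.
Qed.

Lemma sum_geometric_le (R : realType) (A z : R) m : 0 <= A -> 0 <= z < 1 ->
  \sum_(r < m) A * z ^+ r <= A / (1 - z).
Proof.
move=> A0 /andP[z0 z1]; have z1' : 0 < 1 - z by rewrite subr_gt0.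
rewrite -mulr_sumr ler_wpM2l// -div1r ler_pdivlMr// mulrC.
have := subrX1 z m; rewrite -opprB -[z - 1]opprB mulNr => /oppr_inj <-.
by rewrite lerBlDr lerDl exprn_ge0.
Qed.

Section Expectation.
Context (R : realType) (n : nat) (K : rumor_process R n).
Context (d : measure_display) (Omega : measurableType d).
Context (P : probability Omega R) (k : nat) (X : nat -> Omega -> {set 'I_n}).
Hypothesis HX : spread_from K P k X.
Local Notation T := (spread_time R X n).

Lemma measurable_spread_time_le (x : R) :
  measurable [set w | (T w <= x%:E)%E].
Proof.
rewrite spread_time_le_hit; case: ifP => _; first exact: measurable0.
exact: measurable_hit_in HX _ _.
Qed.

Lemma measurable_spread_time : measurable_fun setT (T : Omega -> \bar R).
Proof.
move=> mD; apply: (measurability _ (ErealGenInftyO.measurableE R)) => //.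
move=> _ [_ [x ->] <-]; rewrite setTI.
rewrite (_ : _ @^-1` _ =
  \bigcup_(t in [set t : nat | t%:R < x]) [set w | (T w <= t%:R%:E)%E]).
  by apply: bigcup_measurable => t _; exact: measurable_spread_time_le.
apply/seteqP; split => w /=; rewrite in_itv/=.
  move=> /ereal_inf_lt[_ [t /= nX <-]]; rewrite lte_fin => tx.
  by exists t => //=; apply: ereal_inf_lbound; exists t.
by move=> [t /= tx] /le_lt_trans; apply; rewrite lte_fin.
Qed.

(* Tail summation: [L - #{r < m | T <= L - r}] is a lower bound of [T] as soon
   as [m >= L]. *)
Lemma expected_spread_time_ge (A z L : R) : 0 <= A -> 0 <= z < 1 ->
  (forall r : nat, (P [set w | T w <= (L - r%:R)%:E] <= (A * z ^+ r)%:E)%E) ->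
  ((L - A / (1 - z))%:E <= \int[P]_w T w)%E.
Proof.
move=> A0 z01 tail.
pose m := (Num.truncn L).+1; have Lm : L <= m%:R.
  by rewrite ltW// truncnS_gt.
pose E (r : nat) := [set w | (T w <= (L - r%:R)%:E)%E].
have mE r : measurable (E r) by exact: measurable_spread_time_le.
pose g w : R := \sum_(r < m) \1_(E r) w.
(* Truncation at 0 keeps every integrand nonnegative, so no integrability of [T] has to be known;
   [T >= 0] keeps [Y] below [T]. *)
pose Y w := Num.max 0 (L - g w).
have mg : measurable_fun setT g.
  by apply: measurable_sum => r; exact: measurable_indic.
have mY : measurable_fun setT Y.
  by apply: measurable_maxr => //; exact: measurable_funB.
have g0 w : 0 <= g w by rewrite sumr_ge0.
have YT w : ((Y w)%:E <= T w)%E.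
  apply: le_ereal_inf_tmp => _ [t /= nX <-].
  have Tt : (T w <= t%:R%:E)%E by apply: ereal_inf_lbound; exists t.
  rewrite lee_fin ge_max ler0n/= lerBlDl -lerBlDr.
  apply: le_trans (le_count_nat_le (m := m) _) _.
    by rewrite lerBlDr (le_trans Lm)// lerDl.
  apply: ler_sum => r _; rewrite indicE.
  have [rt|_] := leP r%:R (L - t%:R); last by rewrite ler0n.
  rewrite mem_set//=.
  by rewrite /E /= (le_trans Tt)// lee_fin lerBrDr addrC -lerBrDr.
have Ig : (\int[P]_w (g w)%:E <= (A / (1 - z))%:E)%E.
  under eq_integral do rewrite /g -sumEFin.
  rewrite ge0_integral_sum//; last first.
    by move=> r; apply/measurable_EFinP; exact: measurable_indic.
  apply: le_trans (_ : _ <= (\sum_(r < m) A * z ^+ r)%:E)%E _; last first.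
    by rewrite lee_fin sum_geometric_le.
  rewrite -sumEFin; apply: lee_sum => r _.
  by rewrite integral_indic// setIT; exact: tail.
have LY : (L%:E <= \int[P]_w (Y w)%:E + \int[P]_w (g w)%:E)%E.
  rewrite -ge0_integralD//; last 4 first.
  - by move=> w _; rewrite lee_fin le_max lexx.
  - exact/measurable_EFinP.
  - by move=> w _; rewrite lee_fin.
  - exact/measurable_EFinP.
  have [L0|L0] := leP L 0.
    rewrite (@le_trans _ _ 0%E)// integral_ge0// => w _.
    by rewrite adde_ge0 ?lee_fin ?le_max ?lexx.
  apply: (@le_trans _ _ (\int[P]_w L%:E)%E).
    rewrite integral_cst// [X in (_ * X)%E](_ : _ = 1%E) ?mule1//.
    exact: probability_setT.
  apply: ge0_le_integral => //.
  - by move=> w _; rewrite lee_fin ltW.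
  - by apply: emeasurable_funD; exact/measurable_EFinP.
  - by move=> w _; rewrite -EFinD lee_fin -lerBlDr le_max lexx orbT.
have YT' : (\int[P]_w (Y w)%:E <= \int[P]_w T w)%E.
  apply: ge0_le_integral => //.
  - by move=> w _; rewrite lee_fin le_max lexx.
  - exact/measurable_EFinP.
  - exact: measurable_spread_time.
rewrite EFinB leeBlDr//.
by apply: le_trans LY _; apply: leeD.
Qed.

End Expectation.

(** * The tail bound, with constants uniform in [n] *)

Section Tail.
Context (R : realType) (n : nat) (K : rumor_process R n).
Context (rho rmin rmax a c g : R).
Hypotheses (rmin0 : 0 < rmin) (rho_b : rmin <= rho <= rmax).
Hypotheses (a0 : 0 <= a) (c0 : 0 <= c) (g0 : 0 < g) (g1 : g < 1).
Hypothesis ga : 4 * (a + 1) * g <= expR (- rmax).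
Hypothesis gn1 : 1 <= g * n%:R.
Hypothesis hyp : forall u : nat, (1 <= u)%N -> u%:R <= g * n%:R ->
  expR (- rho) - a * (u%:R / n%:R) <= 1 - success_prob K (n - u)%N /\
  (covariance_number K (n - u)%N <= (c / u%:R)%:E)%E.

Let qmin := expR (- rmax).
(** Chosen so that [s ^ 4 = expR (- rmin)], which is at least [expR (- rho)]. *)
Let s := expR (- rmin / 4).
(** A lower bound of [q * (1 - q)] for all admissible [rho]. *)
Let slack := qmin * (1 - expR (- rmin)).
(** When [geom_level] is at most [level * n], the first entry keeps the threshold below [g * n / 2],
    and the second ensures [k * geom_level <= 1]. *)
Let level := Num.min (g / 6) (slack / (9 * (a + 1))).

Definition tail_const :=
  36 * (1 + c) / (qmin * (1 - s) ^+ 2) / (1 - s ^+ 2) / level.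

Lemma tail_const_ge0 : 0 <= tail_const.
Proof.
have qmin0 : 0 < qmin by exact: expR_gt0.
have s1 : s < 1 by rewrite expR_lt1 mulNr oppr_lt0 divr_gt0.
have qM1 : expR (- rmin) < 1 by rewrite expR_lt1 oppr_lt0.
have slack0 : 0 <= slack by rewrite mulr_ge0 ?(ltW qmin0)// subr_ge0 ltW.
apply: divr_ge0; last first.
  by rewrite le_min divr_ge0 ?(ltW g0)//= divr_ge0// mulr_ge0// addr_ge0.
apply: divr_ge0; last by rewrite subr_ge0 exprn_ile1 ?expR_ge0// ltW.
apply: divr_ge0; first by rewrite mulr_ge0// addr_ge0.
by apply: mulr_ge0 (ltW qmin0) (sqr_ge0 _).
Qed.

Lemma hit_prob_tail (r t : nat) (S : {set 'I_n}) :
  rho * (r + t)%:R <= ln n%:R ->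
  #|S| = (n - Num.truncn (g * n%:R))%N ->
  hit_prob K t S <= tail_const * expR (- rmin * r%:R).
Proof.
move=> rt Sk.
have [rmin_gt0 [a_ge0 [c_ge0 [g_gt0 g_lt1]]]] := (rmin0, (a0, (c0, (g0, g1)))).
have gn1' := gn1; have /andP[rho1 rho2] := rho_b.
have rho0 : 0 < rho by apply: lt_le_trans rho1.
have a1 : 0 < a + 1 by lra.
have n0 : 0 < n%:R :> R.
  by rewrite -(pmulr_rgt0 _ g_gt0) (lt_le_trans ltr01).
pose q := expR (- rho).
have qmin0 : 0 < qmin by exact: expR_gt0.
have q0 : 0 < q by exact: expR_gt0.
have qminq : qmin <= q by rewrite ler_expR lerN2.
have qqM : q <= expR (- rmin) by rewrite ler_expR lerN2.
have qM1 : expR (- rmin) < 1 by rewrite expR_lt1 oppr_lt0.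
have q1 : q < 1 by apply: le_lt_trans qM1.
have s0 : 0 < s by exact: expR_gt0.
have s1 : s < 1 by rewrite expR_lt1 mulNr oppr_lt0 divr_gt0.
have qs : q <= s ^+ 4.
  apply: (le_trans qqM); rewrite /s -expRM_natl ler_expR; lra.
have slack0 : 0 < slack by rewrite mulr_gt0// subr_gt0.
have level0 : 0 < level.
  by rewrite lt_min (divr_gt0 g_gt0)// divr_gt0// mulr_gt0.
(* Then [W / q ^ t = level * expR (rho * (r + t))], which the hypothesis on [r + t] bounds by
   [level * n], while [1 / W] supplies the decay in [r]. *)
pose W := level * expR (rho * r%:R).
have W0 : 0 < W by rewrite mulr_gt0// expR_gt0.
pose b := a / n%:R; have b0 : 0 <= b by rewrite divr_ge0// ltW.
pose k := 9 * b / slack.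
have b9 : 0 <= 9 * b by rewrite mulr_ge0.
have k0 : 0 <= k := divr_ge0 b9 (ltW slack0).
have slackq : slack <= q * (1 - q).
  rewrite /slack ler_pM ?(ltW qmin0)//; first by rewrite subr_ge0 ltW.
  by rewrite lerD2l lerN2.
have bk : 9 * b <= k * (q * (1 - q)).
  by rewrite /k mulrAC ler_pdivlMr// ler_wpM2l.
have bG : 4 * b * (g * n%:R) <= q.
  apply: le_trans qminq; rewrite (_ : _ * _ = 4 * a * g).
    apply: le_trans ga; rewrite !mulrDr ler_pM2r//; lra.
  by rewrite /b; field; rewrite gt_eqF.
have Gn : g * n%:R < n%:R by rewrite gtr_pMl.
have drift u : (1 <= u)%N -> u%:R <= g * n%:R ->
    q - b * u%:R <= 1 - success_prob K (n - u)%N.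
  move=> u1 un; have [+ _] := hyp u1 un; congr (_ - _ <= _).
  by rewrite /b mulrAC mulrA.
have cov u : (1 <= u)%N -> u%:R <= g * n%:R ->
    (covariance_number K (n - u)%N <= (c / u%:R)%:E)%E.
  by move=> u1 un; have [_ +] := hyp u1 un.
have Sc : #|~: S| = Num.truncn (g * n%:R).
  have := cardsC S; rewrite card_ord Sk => /(canRL (addKn _)) ->.
  rewrite subKn// truncn_le_nat (lt_trans Gn)// ltr_nat//.
have yn : geom_level q W t <= level * n%:R.
  rewrite /geom_level /W /q -expRM_natr mulNr expRN invrK -mulrA ler_pM2l//.
  rewrite -expRD -mulrDr -natrD -[leRHS]lnK ?posrE// ler_expR.
  exact: rt.
have ky : k * geom_level q W t <= 1.
  apply: le_trans (ler_wpM2l k0 yn) _.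
  have lev : level <= slack / (9 * (a + 1)) by rewrite ge_min lexx orbT.
  rewrite (_ : k * _ = 9 * a / slack * level); last first.
    by rewrite /k /b; field; rewrite !gt_eqF.
  apply: (@le_trans _ _ (9 * a / slack * (slack / (9 * (a + 1))))).
    by rewrite ler_wpM2l// (divr_ge0 _ (ltW slack0))// mulr_ge0.
  rewrite (_ : _ * _ = a / (a + 1)); last first.
    by field; rewrite !gt_eqF.
  by rewrite ler_pdivrMr// mul1r lerDl.
(* The threshold is at most [3 * level * n <= g * n / 2], and rounding down at most halves a number
   that is at least 1. *)
have wS : threshold q s k W t <= #|~: S|%:R.
  have g6 : level <= g / 6 by rewrite ge_min lexx.
  have h1 : threshold q s k W t <= geom_level q W t * 3.
    rewrite /threshold ler_wpM2l ?(ltW (geom_level_gt0 _ _ _))//.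
    exact: correction_le3.
  have h2 : level * n%:R <= g / 6 * n%:R by rewrite ler_pM2r.
  have T1 : (1 <= Num.truncn (g * n%:R))%N by rewrite truncn_gt0.
  have T2 := truncnS_gt (g * n%:R).
  rewrite Sc; move: T1 T2; rewrite -(ler_nat R) -natr1; lra.
have SG : #|~: S|%:R <= g * n%:R by rewrite Sc truncn_le mulr_ge0// ltW.
apply: le_trans
  (hit_prob_le q0 q1 s0 s1 b0 c0 k0 W0 bk qs bG Gn drift cov ky wS SG) _.
have s2 : 0 < 1 - s ^+ 2 by rewrite subr_gt0 exprn_ilt1// ltW.
rewrite /tail_const /W (invfM level) mulNr expRN.
have ss : 0 < (1 - s) ^+ 2 by rewrite exprn_gt0// subr_gt0.
have num : 0 <= 36 * (1 + c) by rewrite mulr_ge0// addr_ge0.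
rewrite [leLHS]mulrA ler_pM//.
- apply: divr_ge0 (ltW level0); apply: divr_ge0 (ltW s2).
  exact: divr_ge0 num (mulr_ge0 (ltW q0) (ltW ss)).
- apply: ler_wpM2r; first by rewrite invr_ge0 ltW.
  apply: ler_wpM2r; first by rewrite invr_ge0 ltW.
  rewrite ler_wpM2l//.
  by rewrite lef_pV2 ?posrE ?(mulr_gt0 _ ss)// ler_pM2r.
- by rewrite lef_pV2 ?posrE ?expR_gt0// ler_expR ler_wpM2r.
Qed.

End Tail.

(** * Assembly: choice of the constants, and small [n] *)

Theorem theorem38 (R : realType) (rho : nat -> R) (rho_min rho_max g0 a c : R)
  (K : forall n : nat, rumor_process R n)
  (rho_min_gt0 : 0 < rho_min)
  (rho_bounds : forall n, rho_min <= rho n <= rho_max)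
  (g0_gt0 : 0 < g0) (g0_lt1 : g0 < 1) (a_ge0 : 0 <= a) (c_ge0 : 0 <= c)
  (hyp : \forall n \near \oo, forall u : nat,
     (1 <= u)%N -> u%:R <= g0 * n%:R ->
     expR (- rho n) - a * (u%:R / n%:R) <= 1 - success_prob (K n) (n - u)%N /\
     (covariance_number (K n) (n - u)%N <= (c / u%:R)%:E)%E) :
  exists g' : R, [/\ 0 < g', g' < 1 &
  exists2 alpha' : R, 0 < alpha' &
  forall g : R, 0 < g -> g < g' ->
  exists2 A' : R, 0 < A' &
  exists2 h : nat -> R, (exists C : R, forall n, `|h n| <= C) &
  forall (n : nat) (d : measure_display) (Omega : measurableType d)
    (P : probability Omega R) (X : nat -> Omega -> {set 'I_n}),
    (0 < n)%N ->
    spread_from (K n) P (n - Num.truncn (g * n%:R))%N X ->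
    (((rho n)^-1 * ln n%:R + h n)%:E <= \int[P]_w spread_time R X n w)%E /\
    (forall r : nat,
      (P [set w | spread_time R X n w <= ((rho n)^-1 * ln n%:R - r%:R)%:E] <=
       (A' * expR (- alpha' * r%:R))%:E)%E)].
Proof.
case: hyp => N _ hyp.
(* The second entry keeps the quadratic loss below a quarter of [expR (- rho n)]; [a + 1] instead of
   [a] avoids a zero divisor. *)
pose g' := Num.min g0 (expR (- rho_max) / (4 * (a + 1))).
have a1 : 0 < a + 1 by rewrite ltr_wpDl.
exists g'; split.
- by rewrite lt_min g0_gt0 divr_gt0 ?expR_gt0// mulr_gt0.
- by rewrite gt_min g0_lt1.
(* The decay in [r] has rate [rho n]; [rho_min] is a rate common to all [n]. *)
exists rho_min => // g g_gt0; rewrite lt_min => /andP[gg0 ga].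
have {}ga : 4 * (a + 1) * g <= expR (- rho_max).
  by rewrite mulrC -ler_pdivlMr ?mulr_gt0// ltW.
have g_lt1 : g < 1 := lt_trans gg0 g0_lt1.
(* Beyond [m] the hypotheses are in force and [g * n >= 1]. *)
pose m := maxn N (Num.truncn g^-1).+1.
pose A0 := tail_const rho_min rho_max a c g.
have A0_ge0 : 0 <= A0 by exact: tail_const_ge0.
(* The summand [expR m%:R] makes the tail bound at least 1 for [n <= m]: unless the event is empty,
   [rho_min * r <= ln n <= m]. *)
pose A' := A0 + expR m%:R.
have A'_gt0 : 0 < A' by rewrite ltr_wpDl// expR_gt0.
exists A' => //.
pose z := expR (- rho_min).
have z01 : 0 <= z < 1 by rewrite expR_ge0 expR_lt1 oppr_lt0.
exists (fun=> - (A' / (1 - z))); first by exists (`|- (A' / (1 - z))|).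
move=> n d Omega P X n_gt0 HX.
have /andP[rho1 _] := rho_bounds n.
have rho_gt0 : 0 < rho n := lt_le_trans rho_min_gt0 rho1.
suff tail r :
    (P [set w | spread_time R X n w <= ((rho n)^-1 * ln n%:R - r%:R)%:E] <=
       (A' * expR (- rho_min * r%:R))%:E)%E.
  split=> //; apply: (expected_spread_time_ge HX (ltW A'_gt0) z01) => r.
  by rewrite /z -expRM_natr.
rewrite spread_time_le_hit; case: ltP => [_|x0].
  by rewrite measure0 lee_fin mulr_ge0 ?expR_ge0// ltW.
have rn : rho n * r%:R <= ln n%:R.
  by move: x0; rewrite subr_ge0 mulrC ler_pdivlMr// mulrC.
have [nm|mn] := leqP n m.
  apply: (@le_trans _ _ 1%E).
    by apply: probability_le1; exact: measurable_hit_in HX _ _.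
  rewrite lee_fin (@le_trans _ _ (expR m%:R * expR (- rho_min * r%:R)))//.
    rewrite -expRD -[leLHS]expR0 ler_expR mulNr subr_ge0.
    apply: (@le_trans _ _ (rho n * r%:R)); first by rewrite ler_wpM2r.
    apply: (le_trans rn); apply: (@le_trans _ _ n%:R); last by rewrite ler_nat.
    by rewrite ltW// ln_sublinear// ltr0n.
  by rewrite ler_wpM2r ?expR_ge0// lerDr.
apply: (@le_trans _ _ (A0 * expR (- rho_min * r%:R))%:E); last first.
  by rewrite lee_fin ler_wpM2r ?expR_ge0// lerDl expR_ge0.
have [Nn gn] : (N <= n)%N /\ (Num.truncn g^-1 < n)%N.
  by apply/andP; rewrite -geq_max ltnW.
have gn1 : 1 <= g * n%:R.
  rewrite -ler_pdivrMl// mulr1 ltW// (lt_le_trans (truncnS_gt _))//.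
  by rewrite ler_nat.
apply: (prob_hit_le HX) => [|S Sk].
  by rewrite mulr_ge0// expR_ge0.
apply: (@hit_prob_tail R n (K n) (rho n) rho_min rho_max a c g) => //.
- move=> u u1 ug; apply: hyp => //; apply: le_trans ug _.
  by rewrite ler_wpM2r// ltW.
(* The number of rounds is [t = Num.truncn (ln n / rho n - r)], whence [rho n * (r + t) <= ln n]. *)
- have := x0; rewrite -truncn_le lerBrDl -natrD [_^-1 * _]mulrC ler_pdivlMr//.
  by rewrite [_ * rho n]mulrC.
Qed.
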